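(* Let $K\subset\mathbb R^N$ be a closed set such that $\underline{\mathcal P}^{\psi,w}_K\ne\emptyset$, and let $\phi_1,\dots,\phi_N:X\to\mathbb R$ be bounded and upper semicontinuous. Then there exists a weak subpartition $\vec\mu\in\underline{\mathcal P}^{\psi,w}_K$ which maximizes the total profit $$\vec\mu\mapsto\int_X\vec\phi\cdot d\vec\mu:=\sum_{i=1}^N\int_X\phi_i\,d\mu_i$$ over $\underline{\mathcal P}^{\psi,w}_K$.
   Context: $X$ is a compact Polish space with its Borel $\sigma$-algebra, $\mu$ is a non-atomic Borel probability measure on $X$, and $\psi_1,\dots,\psi_N:X\to\mathbb R$ are continuous. For $\vec m\in\mathbb R^N$, $\underline{\mathcal P}^{\psi,w}_{\vec m}$ (weak subpartitions) is the set of $N$-tuples $\vec\mu=(\mu_1,\dots,\mu_N)$ of non-negative Borel measures on $X$ with $\sum_{i=1}^N\mu_i\le\mu$ and $\int_X\psi_i\,d\mu_i=m_i$ for $i=1,\dots,N$. For $K\subset\mathbb R^N$, $\underline{\mathcal P}^{\psi,w}_K=\bigcup_{\vec m\in K}\underline{\mathcal P}^{\psi,w}_{\vec m}$. *)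

(* Defs.v *)
From mathcomp Require Import all_boot all_order all_algebra.
From mathcomp Require Import all_classical all_reals all_analysis.

Set Implicit Arguments.
Unset Strict Implicit.
Unset Printing Implicit Defensive.

Import Order.TTheory GRing.Theory Num.Theory.
Import numFieldNormedType.Exports.

Local Open Scope classical_set_scope.
Local Open Scope ring_scope.

Notation Borel X := (g_sigma_algebraType (@open X)).

Definition separable (T : topologicalType) : Prop :=
  exists2 D : set T, countable D & dense D.

Definition homeomorphic (T U : topologicalType) : Prop :=
  exists (f : T -> U) (g : U -> T),
    [/\ cancel f g, cancel g f, continuous f & continuous g].

(* The property of the library's [completeType], without the base point. *)
Definition complete_space (T : uniformType) : Prop :=
  forall F : set_system T, ProperFilter F -> cauchy F -> exists l : T, F --> l.

Definition polish (R : realType) (T : topologicalType) : Prop :=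
  separable T /\
  exists M : metricType R, complete_space M /\ homeomorphic T M.

Definition upper_semicontinuous (R : realType) (T : topologicalType)
    (f : T -> R) : Prop :=
  forall x a, f x < a -> \forall y \near x, f y < a.

Local Open Scope ereal_scope.

Definition non_atomic d (T : measurableType d) (R : realType)
    (mu : {measure set T -> \bar R}) : Prop :=
  forall A, measurable A -> 0 < mu A ->
    exists B, [/\ measurable B, B `<=` A, 0 < mu B & mu B < mu A].

Section weak_subpartitions.
Context (R : realType) (X : ptopologicalType) (N : nat).
Implicit Types (mu : {measure set (Borel X) -> \bar R})
  (psi phi : 'I_N -> X -> R) (m : 'rV[R]_N) (K : set 'rV[R]_N)
  (nu : 'I_N -> {measure set (Borel X) -> \bar R}).

Definition weak_subpartition mu psi m :
    set ('I_N -> {measure set (Borel X) -> \bar R}) :=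
  [set nu |
    (forall A : set (Borel X), measurable A -> \sum_(i < N) nu i A <= mu A) /\
    (forall i, \int[nu i]_x (psi i x)%:E = (m ord0 i)%:E)].

Definition weak_subpartition_in mu psi K :
    set ('I_N -> {measure set (Borel X) -> \bar R}) :=
  \bigcup_(m in K) weak_subpartition mu psi m.

Definition total_profit phi nu : \bar R :=
  \sum_(i < N) \int[nu i]_x (phi i x)%:E.

End weak_subpartitions.

(* Main.v *)
From HB Require Import structures.
Require Import Defs.
From mathcomp Require Import all_boot all_order all_algebra.
From mathcomp Require Import all_classical all_reals all_analysis.
From mathcomp Require Import measurable_realfun lra.

Set Implicit Arguments.
Unset Strict Implicit.
Unset Printing Implicit Defensive.

Import Order.TTheory GRing.Theory Num.Theory.
Import numFieldNormedType.Exports HBSimple.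

Local Open Scope classical_set_scope.
Local Open Scope ring_scope.

(** The theorem is the direct method: the weak subpartitions form a compact
set, on which the constraints are closed and the profit is continuous.  The
topology that makes this work is setwise convergence: a family of measures
converges when its value on every Borel set does.

Compactness comes from the domination by [mu].  Each [nu i A] lies in
[[0, mu A]], so along an ultrafilter all these numbers converge
([bounded_ultra_cvg]).  The limits are finitely additive, and a finitely
additive set function below a finite measure is automatically countably
additive, because its mass on the tail of a disjoint union is squeezed by that
of [mu] ([dominated_content_sigma_additive]).  So the limit is again a measure
([dominated_setwise_limit]).

Continuity comes from the density of simple functions in L1(mu).  Setwise
convergence gives the convergence of the integrals of simple functions, and
domination makes the error of approximating [f] by a simple function uniform
over the family ([setwise_cvg_Rintegral]).  This applies to the [psi i] and
the [phi i]: being upper semicontinuous they are Borel, and being bounded they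
are integrable.

Finally a maximizer is obtained without computing the supremum.  The sets of
feasible points at least as profitable as a given one are nested, so they lie
in a common ultrafilter ([total_preorder_ultrafilter]); the limit along it is
at least as profitable as every feasible point, and is feasible since [K] is
closed. *)

(** * Ultrafilters and limits *)

(** Compactness of a segment, along a function that need not be onto: the image
of an ultrafilter clusters somewhere in the segment, and an ultrafilter that
clusters at a point converges to it. *)
Lemma bounded_ultra_cvg (R : realType) (I : Type) (U : set_system I)
    (u : I -> R) (a b : R) :
  UltraFilter U -> (forall j, a <= u j <= b) ->
  exists l : R, u j @[j --> U] --> l.
Proof.
move=> UU uab; have PU : ProperFilter U := @ultra_proper _ _ UU.
have [|l [_ cl]] := @segment_compact R a b (u j @[j --> U])
  (fmap_proper_filter u PU).
  by apply: (@filterE _ U) => j /=; rewrite in_itv/=; exact: uab.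
exists l => A Al; have [//|UA] := in_ultra_setVsetC (u @^-1` A) UU.
by have [x []] := cl (~` A) A UA Al.
Qed.

(** The upper sets of a total preorder are nested, so they generate a proper
filter.  An ultrafilter above it eventually dominates every index, and so
replaces a maximizing sequence. *)
Lemma total_preorder_ultrafilter (I : Type) (d : Order.disp_t)
    (V : orderType d) (F : I -> V) :
  inhabited I -> exists2 U : set_system I, UltraFilter U &
    forall i, \forall j \near U, (F i <= F j)%O.
Proof.
move=> [i0]; pose B i := [set j | (F i <= F j)%O].
have PB : ProperFilter (filter_from [set: I] B).
  apply: (filter_from_proper (filter_from_filter _ _)); first by exists i0.
    move=> i k _ _; wlog ik : i k / (F i <= F k)%O => [W|].
      have [/W//|/ltW/W[m _]] := leP (F i) (F k).
      by rewrite setIC; exists m.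
    by exists k => // j kj; split => //; exact: le_trans kj.
  by move=> i _; exists i; exact: lexx.
have [U [UU BU]] := ultraFilterLemma PB.
by exists U => // i; apply: BU; exists i.
Qed.

Lemma cvg_row (R : realType) (N : nat) (I : Type) (U : set_system I)
    (u : I -> 'rV[R]_N) (l : 'rV[R]_N) :
  Filter U -> (forall i, u j ord0 i @[j --> U] --> l ord0 i) ->
  u j @[j --> U] --> l.
Proof.
move=> FU ul A [P lP PA].
have : \forall j \near U, forall i, P ord0 i (u j ord0 i).
  by apply: filter_forall => i; exact: (ul i _ (lP ord0 i)).
by apply: filterS => j uP; apply: PA => k i; rewrite (ord1 k).
Qed.

(** * Measurability and boundedness of the integrands *)

Lemma upper_semicontinuous_measurable (R : realType) (X : ptopologicalType)
    (f : X -> R) :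
  upper_semicontinuous f -> measurable_fun [set: Borel X] f.
Proof.
move=> f_usc; apply: (measurability _ (RGenInftyO.measurableE R)).
move=> _ [_ [a ->] <-]; rewrite setTI; apply: sub_sigma_algebra.
rewrite openE => x /=; rewrite in_itv/= => fxa.
by apply: filterS (f_usc x a fxa) => y; rewrite /= in_itv.
Qed.

Lemma continuous_upper_semicontinuous (R : realType) (T : topologicalType)
    (f : T -> R) : continuous f -> upper_semicontinuous f.
Proof. by move=> f_cont x a fxa; exact: (cvgr_lt _ (f_cont x)). Qed.

Lemma compact_continuous_bounded (R : realType) (T : topologicalType)
    (f : T -> R) : compact [set: T] -> continuous f -> bounded_fun f.
Proof.
move=> T_compact f_cont.
have : bounded_set (range f).
  apply: compact_bounded; apply: continuous_compact => //.
  exact: continuous_subspaceT.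
by case=> M [Mreal MP]; exists M; split=> // y /MP fy x _; apply: fy; exists x.
Qed.

(** * Measures dominated by a finite measure *)

Lemma dominated_fin_num d (T : measurableType d) (R : realType)
    (mu : {measure set T -> \bar R}) (nu : {content set T -> \bar R})
    (A : set T) :
  (mu setT < +oo)%E -> (forall A, measurable A -> nu A <= mu A)%E ->
  measurable A -> nu A \is a fin_num.
Proof.
move=> mu_fin nu_le_mu mA; rewrite ge0_fin_numE//.
apply: le_lt_trans (nu_le_mu A mA) _; apply: le_lt_trans mu_fin.
by rewrite le_measure ?inE.
Qed.

(** Countable additivity passes from a finite measure down to any content below
it: on a disjoint union, the partial sums of [nu] miss only the mass of the
tail, which is at most the mass of the tail for [mu], and that tends to 0. *)
Lemma dominated_content_sigma_additive d (T : measurableType d) (R : realType)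
    (mu : {measure set T -> \bar R}) (nu : {content set T -> \bar R}) :
  (mu setT < +oo)%E ->
  (forall A, measurable A -> nu A <= mu A)%E ->
  semi_sigma_additive nu.
Proof.
move=> mu_fin nu_le_mu F mF tF mUF.
have mu_lty A : measurable A -> (mu A < +oo)%E.
  by move=> mA; apply: le_lt_trans mu_fin; rewrite le_measure ?inE.
pose tail n := \bigcup_k F k `\` \big[setU/set0]_(k < n) F k.
have mtail n : measurable (tail n).
  by apply: measurableD => //; exact: bigsetU_measurable.
have mB n : measurable (\big[setU/set0]_(k < n) F k).
  exact: bigsetU_measurable.
have mu_tail : mu (tail n) @[n --> \oo] --> 0%E.
  have tail0 : \bigcap_n tail n = set0.
    apply/seteqP; split => // x /= tx; have [[k _ Fkx] _] := tx 0%N Logic.I.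
    have [_] := tx k.+1 Logic.I; apply.
    by rewrite big_ord_recr/=; right.
  rewrite -(measure0 mu) -tail0; apply: nonincreasing_cvg_mu => //.
  - exact: mu_lty.
  - by rewrite tail0.
  - move=> m n mn; apply/subsetPset; apply: setDS.
    exact: subset_bigsetU.
have nu_tail : nu (tail n) @[n --> \oo] --> 0%E.
  apply: (@squeeze_cvge _ _ _ _ (fun=> 0%E) _ (mu \o tail)) => //.
  - by apply: nearW => n /=; rewrite measure_ge0 nu_le_mu.
  - exact: cvg_cst.
have nu_fin A : measurable A -> nu A \is a fin_num.
  exact: dominated_fin_num mu_fin nu_le_mu.
have sumE n : (\sum_(0 <= k < n) nu (F k) =
    nu (\bigcup_k F k) - nu (tail n))%E.
  rewrite big_mkord -(measure_semi_additive_ord_I nu)//; last first.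
    exact: sub_trivIset tF.
  rewrite measureD//; last first.
    by rewrite -ge0_fin_numE ?nu_fin.
  rewrite setIidr; last by rewrite -bigcup_mkord => x [k _ ?]; exists k.
  by rewrite fin_num_oppeB ?addeA ?subee ?add0e ?nu_fin.
under eq_fun do rewrite sumE.
have : (nu (\bigcup_k F k) - nu (tail n) @[n --> \oo] -->
    nu (\bigcup_k F k) - 0)%E.
  apply: cvgeB => //; last exact: cvg_cst.
  by rewrite fin_num_adde_defl.
by rewrite sube0.
Qed.

(** Setwise compactness: the limit of [nu j A] along the ultrafilter exists for
each measurable [A] separately, and additivity and domination are closed
conditions, so the limits assemble into a measure. *)
Lemma dominated_setwise_limit d (T : measurableType d) (R : realType)
    (mu : {measure set T -> \bar R}) (I : Type) (U : set_system I)
    (nu : I -> {measure set T -> \bar R}) :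
  (mu setT < +oo)%E -> UltraFilter U ->
  (forall j A, measurable A -> nu j A <= mu A)%E ->
  exists L : {measure set T -> \bar R},
    (forall A, measurable A -> L A <= mu A)%E /\
    (forall A, measurable A -> fine (nu j A) @[j --> U] --> fine (L A)).
Proof.
move=> mu_fin UU nu_le_mu; have PU : ProperFilter U := @ultra_proper _ _ UU.
have mu_finN A : measurable A -> mu A \is a fin_num.
  by apply: dominated_fin_num mu_fin _ => B _; exact: lexx.
have nu_finN j A : measurable A -> nu j A \is a fin_num.
  exact: dominated_fin_num mu_fin (nu_le_mu j).
(* A measure has to be nonnegative on all sets, so the limit function also gets
   a value on the non-measurable ones: 0. *)
have /choice[l lP] : forall A, exists l : R, [/\ 0 <= l,
    measurable A -> (l%:E <= mu A)%E &
    measurable A -> fine (nu j A) @[j --> U] --> l].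
  move=> A; have [mA|nmA] := pselect (measurable A); last by exists 0.
  have nuA j : 0 <= fine (nu j A) <= fine (mu A).
    by rewrite fine_ge0//= fine_le ?nu_finN ?mu_finN ?nu_le_mu.
  have [l nul] := bounded_ultra_cvg UU nuA.
  have : `[0, fine (mu A)]%classic l.
    apply: closed_cvg nul; first exact: itv_closed.
    by apply: nearW => j; rewrite /= in_itv; exact: nuA.
  rewrite /= in_itv/= => /andP[l0 lmu]; exists l; split => // _.
  by rewrite -(fineK (mu_finN _ mA)) lee_fin.
pose L A := (l A)%:E.
have L0 A : (0 <= L A)%E by rewrite lee_fin; have [] := lP A.
have Ladd : measure_function.semi_additive L.
  move=> F n mF tF mUF; rewrite /L sumEFin; congr EFin.
  have [_ _ /(_ mUF) nuU] := lP (\big[setU/set0]_(k < n) F k).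
  apply: (cvg_unique _ nuU) => //.
  have -> : (fun j => fine (nu j (\big[setU/set0]_(k < n) F k))) =
            (fun j => \sum_(k < n) fine (nu j (F k))).
    apply/funext => j; rewrite (measure_semi_additive_ord_I (nu j))//.
      by rewrite sum_fine// => i _; exact: nu_finN.
    exact: sub_trivIset tF.
  apply: cvg_big => [|k _]; first exact: add_continuous.
  by have [_ _] := lP (F k); apply.
pose LC : {content set T -> \bar R} :=
  HB.pack L (isContent.Build d T R L L0 Ladd).
have Lsigma : semi_sigma_additive L.
  apply: (dominated_content_sigma_additive (nu := LC) mu_fin) => A mA.
  by have [_ /(_ mA)] := lP A.
pose LM : {measure set T -> \bar R} :=
  HB.pack L (isMeasure.Build d T R L (measure0 LC) L0 Lsigma).
by exists LM; split=> A mA; have [_] := lP A; auto.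
Qed.

(** * Integrals under domination *)

Lemma dominated_integrable d (T : measurableType d) (R : realType)
    (mu nu : {measure set T -> \bar R}) (f : T -> \bar R) :
  (forall A, measurable A -> nu A <= mu A)%E ->
  mu.-integrable setT f -> nu.-integrable setT f.
Proof.
move=> nu_le_mu /integrableP[mf fmu]; apply/integrableP; split => //.
apply: le_lt_trans fmu; apply: ge0_le_measure_integral => //.
by apply: measurableT_comp.
Qed.

Lemma dominated_integral_EFin d (T : measurableType d) (R : realType)
    (mu nu : {measure set T -> \bar R}) (f : T -> R) :
  (forall A, measurable A -> nu A <= mu A)%E ->
  mu.-integrable setT (EFin \o f) ->
  (\int[nu]_x (f x)%:E = (\int[nu]_x f x)%:E)%E.
Proof.
move=> nu_le_mu /(dominated_integrable nu_le_mu) fi.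
by rewrite /Rintegral fineK//; exact: integrable_fin_num.
Qed.

(** The bound on the right depends on [mu] alone: approximation in L1(mu) is
uniform over all measures below [mu]. *)
Lemma dominated_Rintegral_dist d (T : measurableType d) (R : realType)
    (mu nu : {measure set T -> \bar R}) (f g : T -> R) :
  (forall A, measurable A -> nu A <= mu A)%E ->
  mu.-integrable setT (EFin \o f) -> mu.-integrable setT (EFin \o g) ->
  (`|\int[nu]_x f x - \int[nu]_x g x|%:E <=
     \int[mu]_x `|(f x)%:E - (g x)%:E|)%E.
Proof.
move=> nu_le_mu fi gi.
have fgi := integrableB measurableT fi gi.
have [fn gn fgn] := And3 (dominated_integrable nu_le_mu fi)
  (dominated_integrable nu_le_mu gi) (dominated_integrable nu_le_mu fgi).
have mfg := measurable_int _ fgi.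
rewrite -RintegralB// EFin_normr_Rintegral//.
apply: (le_trans (le_abse_integral _ _ _)) => //.
apply: ge0_le_measure_integral => //.
by apply: measurableT_comp.
Qed.

Lemma Rintegral_step d (T : measurableType d) (R : realType)
    (m : {measure set T -> \bar R}) (A : R -> set T) (s : seq R) :
  (m setT < +oo)%E -> (forall y, measurable (A y)) ->
  \int[m]_x (\sum_(y <- s) y * \1_(A y) x) = \sum_(y <- s) y * fine (m (A y)).
Proof.
move=> m_fin mA.
have iI y : m.-integrable setT (EFin \o \1_(A y)).
  apply/integrableP; split; first exact/measurable_EFinP/measurable_indic.
  under eq_integral do rewrite /= ger0_norm//.
  by rewrite integral_indic// setIT; apply: le_lt_trans m_fin;
    rewrite le_measure ?inE.
have iZ y : m.-integrable setT (EFin \o (fun x => y * \1_(A y) x)).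
  by apply: eq_integrable (integrableZl measurableT y (iI y)).
have iS r : m.-integrable setT
    (EFin \o (fun x => \sum_(y <- r) y * \1_(A y) x)).
  rewrite (_ : _ \o _ = fun x => \sum_(y <- r) (y * \1_(A y) x)%:E)%E.
    apply: (@integrable_sum _ _ _ _ _ measurableT _ r xpredT
      (fun y x => (y * \1_(A y) x)%:E)) => // y _.
    exact: iZ.
  by apply/funext => x /=; rewrite sumEFin.
elim: s => [|y s IH].
  rewrite big_nil; under eq_Rintegral do rewrite big_nil.
  by rewrite Rintegral_cst// mul0r.
rewrite big_cons; under eq_Rintegral do rewrite big_cons.
rewrite RintegralD// IH RintegralZl//; congr (_ * _ + _).
by rewrite /Rintegral integral_indic// setIT.
Qed.

(** A three-epsilon argument: a simple function close to [f] in L1(mu) has its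
integral close to that of [f] for all [nu j] and for [L] at once, and the
integral of a simple function is a finite combination of values on sets. *)
Lemma setwise_cvg_Rintegral d (T : measurableType d) (R : realType)
    (mu : {measure set T -> \bar R}) (I : Type) (U : set_system I)
    (nu : I -> {measure set T -> \bar R}) (L : {measure set T -> \bar R})
    (f : T -> R) :
  (mu setT < +oo)%E -> Filter U ->
  (forall j A, measurable A -> nu j A <= mu A)%E ->
  (forall A, measurable A -> L A <= mu A)%E ->
  (forall A, measurable A -> fine (nu j A) @[j --> U] --> fine (L A)) ->
  mu.-integrable setT (EFin \o f) ->
  \int[nu j]_x f x @[j --> U] --> \int[L]_x f x.
Proof.
move=> mu_fin FU nu_le_mu L_le_mu nuL fi.
have [g [gi _ fg]] := approximation_sfun_integrable measurableT fi.
apply/cvgrPdist_lt => e e0.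
have e30 : 0 < e / 3 by rewrite divr_gt0.
have [n fgn] : exists n, (\int[mu]_z `|(f z)%:E - (g n z)%:E| < (e / 3)%:E)%E.
  have /fg : nbhs (0%E : \bar R) [set y | (y < (e / 3)%:E)%E].
    apply: open_nbhs_nbhs; split; first exact: open_ereal_lt_ereal.
    by rewrite /= lte_fin.
  by case=> n _ /(_ n (leqnn n)); exists n.
have far (m : {measure set T -> \bar R}) :
    (forall A, measurable A -> m A <= mu A)%E ->
    `|\int[m]_x f x - \int[m]_x g n x| < e / 3.
  move=> m_le_mu; rewrite -lte_fin; apply: le_lt_trans fgn.
  exact: dominated_Rintegral_dist.
have gE (m : {measure set T -> \bar R}) :
    (forall A, measurable A -> m A <= mu A)%E ->
    \int[m]_x g n x = \sum_(y <- finmap.enum_fset (fset_set (range (g n))))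
      y * fine (m (g n @^-1` [set y])).
  move=> m_le_mu; rewrite -Rintegral_step//.
    by apply: eq_Rintegral => x _; rewrite fimfunE fsbig_finite.
  by apply: le_lt_trans mu_fin; exact: m_le_mu.
have : \int[nu j]_x g n x @[j --> U] --> \int[L]_x g n x.
  rewrite gE//; under eq_fun do rewrite (gE _ (nu_le_mu _)).
  apply: cvg_big => [|y _]; first exact: add_continuous.
  by apply: cvgM; [exact: cvg_cst|exact: nuL].
move=> /cvgrPdist_lt /(_ _ e30); apply: filterS => j gj.
have := far _ (nu_le_mu j); have := far _ L_le_mu; move: gj.
rewrite !ltr_norml => /andP[? ?] /andP[? ?] /andP[? ?].
by apply/andP; split; lra.
Qed.

(** * Existence of an optimal weak subpartition *)

Lemma weak_subpartition_dominated (R : realType) (X : ptopologicalType)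
    (mu : {measure set (Borel X) -> \bar R}) (N : nat)
    (psi : 'I_N -> X -> R) (K : set 'rV[R]_N)
    (nu : 'I_N -> {measure set (Borel X) -> \bar R}) (i : 'I_N)
    (A : set (Borel X)) :
  weak_subpartition_in mu psi K nu -> measurable A -> (nu i A <= mu A)%E.
Proof.
move=> [m _ [nu_le _]] mA; apply: le_trans (nu_le A mA).
by rewrite (bigD1 i)//= leeDl//; exact: sume_ge0.
Qed.

Lemma total_profit_EFin (R : realType) (X : ptopologicalType)
    (mu : {measure set (Borel X) -> \bar R}) (N : nat) (phi : 'I_N -> X -> R)
    (nu : 'I_N -> {measure set (Borel X) -> \bar R}) :
  (forall i A, measurable A -> nu i A <= mu A)%E ->
  (forall i, mu.-integrable setT (EFin \o phi i)) ->
  total_profit phi nu = (\sum_(i < N) \int[nu i]_x phi i x)%:E.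
Proof.
move=> nu_le phi_int; rewrite -sumEFin; apply: eq_bigr => i _.
exact: dominated_integral_EFin (nu_le i) (phi_int i).
Qed.

Theorem theorem3p1 (R : realType) (X : ptopologicalType)
    (X_compact : compact [set: X]) (X_polish : polish R X)
    (mu : probability (Borel X) R) (mu_na : non_atomic mu)
    (N : nat) (psi : 'I_N -> X -> R) (psi_cont : forall i, continuous (psi i))
    (K : set 'rV[R]_N) (K_closed : closed K)
    (K_feasible : weak_subpartition_in mu psi K !=set0)
    (phi : 'I_N -> X -> R)
    (phi_bounded : forall i, bounded_fun (phi i))
    (phi_usc : forall i, upper_semicontinuous (phi i)) :
  exists2 nu, weak_subpartition_in mu psi K nu &
    forall nu', weak_subpartition_in mu psi K nu' ->
      (total_profit phi nu' <= total_profit phi nu)%E.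
Proof.
have mu_fin : (mu setT < +oo)%E by rewrite probability_setT ltry.
have integrable_usc (f : X -> R) : bounded_fun f -> upper_semicontinuous f ->
    mu.-integrable setT (EFin \o f).
  move=> f_bd f_usc; apply: measurable_bounded_integrable => //.
  exact: upper_semicontinuous_measurable.
have phi_int i := integrable_usc _ (phi_bounded i) (phi_usc i).
have psi_int i : mu.-integrable setT (EFin \o psi i).
  apply: integrable_usc; first exact: compact_continuous_bounded.
  exact: continuous_upper_semicontinuous.
(* The index type is the feasible set itself, so that the family of measures
   along which limits are taken is dominated at every index. *)
pose I := {nu | weak_subpartition_in mu psi K nu}.
pose p (s : I) : 'I_N -> {measure set (Borel X) -> \bar R} := sval s.
have p_le s i A : measurable A -> (p s i A <= mu A)%E.
  exact: weak_subpartition_dominated (svalP s).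
have I_inh : inhabited I.
  by have [nu nuP] := K_feasible; exact: (inhabits (exist _ nu nuP)).
have [U UU U_max] :=
  total_preorder_ultrafilter (fun s : I => total_profit phi (p s)) I_inh.
have PU : ProperFilter U := @ultra_proper _ _ UU.
have /choice[nu nuP] i := dominated_setwise_limit mu_fin UU
  (fun s => p_le s i).
have nu_le i : forall A, measurable A -> (nu i A <= mu A)%E := (nuP i).1.
have int_cvg i f : mu.-integrable setT (EFin \o f) ->
    \int[p s i]_x f x @[s --> U] --> \int[nu i]_x f x.
  apply: (setwise_cvg_Rintegral mu_fin) => //; last exact: (nuP i).2.
  - by move=> s; exact: p_le.
  - exact: nu_le.
exists nu.
  exists (\row_i \int[nu i]_x psi i x).
    pose m (s : I) := \row_i \int[p s i]_x psi i x.
    have m_cvg : m s @[s --> U] --> \row_i \int[nu i]_x psi i x.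
      apply: cvg_row => i; rewrite mxE.
      under eq_fun do rewrite mxE.
      exact: int_cvg.
    apply: closed_cvg m_cvg => //; apply: nearW => s.
    have [k Kk [_ ks]] := svalP s.
    suff -> : m s = k by [].
    apply/rowP => i; rewrite mxE; apply: EFin_inj.
    rewrite -(dominated_integral_EFin _ (psi_int i)); first exact: ks.
    exact: p_le.
  split=> [A mA|i]; last first.
    by rewrite mxE (dominated_integral_EFin (nu_le i) (psi_int i)).
  have nuA_fin i : nu i A \is a fin_num.
    exact: dominated_fin_num mu_fin (nu_le i) mA.
  have pA_fin s i : p s i A \is a fin_num.
    exact: dominated_fin_num mu_fin (p_le s i) mA.
  have sum_cvg : \sum_(i < N) fine (p s i A) @[s --> U] -->
      \sum_(i < N) fine (nu i A).
    apply: cvg_big => [|i _]; first exact: add_continuous.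
    exact: (nuP i).2.
  rewrite -[leRHS]fineK; last exact: fin_num_measure.
  rewrite (eq_bigr (fun i => (fine (nu i A))%:E)); last first.
    by move=> i _; rewrite fineK.
  rewrite sumEFin lee_fin; apply: (cvgr_to_le sum_cvg).
  apply: nearW => s; rewrite /= sum_fine//; apply: fine_le.
  - by apply/sum_fin_numP => i _ _; exact: pA_fin.
  - exact: fin_num_measure.
  - by have [m _ [+ _]] := svalP s; exact.
move=> nu' nu'P.
have sum_cvg : \sum_(i < N) \int[p s i]_x phi i x @[s --> U] -->
    \sum_(i < N) \int[nu i]_x phi i x.
  apply: cvg_big => [|i _]; first exact: add_continuous.
  exact: int_cvg.
pose s' : I := exist _ nu' nu'P.
rewrite -[nu']/(p s') (total_profit_EFin (p_le s') phi_int).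
rewrite (total_profit_EFin nu_le phi_int) lee_fin.
apply: (cvgr_to_ge sum_cvg); apply: filterS (U_max s') => s.
by rewrite !(total_profit_EFin (p_le _) phi_int) lee_fin.
Qed.
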